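(* For every pair of prime numbers $p,q$, the balleans $\ell\text{-}\mathcal L(\mathbb Z_{p^\infty})$ and $\ell\text{-}\mathcal L(\mathbb Z_{q^\infty})$ are asymorphic. Moreover, $\operatorname{asdim}\ell\text{-}\mathcal L(\mathbb Z_{p^\infty})=1$.
   Context: A ballean is a triple $(X,P,B)$ where $X,P$ are sets, $P\ne\emptyset$, and $B\colon X\times P\to\mathcal P(X)$ satisfies: $x\in B(x,\alpha)$; $x\in B(y,\alpha)$ iff $y\in B(x,\alpha)$; and for all $\alpha,\beta\in P$ there is $\gamma\in P$ such that $B(B(x,\alpha),\beta)\subseteq B(x,\gamma)$ for every $x\in X$, where $B(A,\delta)=\bigcup_{y\in A}B(y,\delta)$. An extended metric (a metric allowed to take the value $\infty$) $d$ on $X$ induces the metric ballean $(X,\mathbb R_{\ge0},B_d)$, with $B_d(x,R)$ the closed ball of centre $x$ and radius $R$. A map $f\colon X\to Y$ between balleans $(X,P_X,B_X)$ and $(Y,P_Y,B_Y)$ is bornologous if for every $\alpha\in P_X$ there is $\beta\in P_Y$ with $f(B_X(x,\alpha))\subseteq B_Y(f(x),\beta)$ for all $x\in X$. An asymorphism is a bijection $f$ such that $f$ and $f^{-1}$ are bornologous; two balleans are asymorphic if there is an asymorphism between them. A ballean $(X,P,B)$ has asymptotic dimension at most $n\in\mathbb N$ if for every $\alpha\in P$ there is a cover $\mathcal U=\mathcal U_0\cup\dots\cup\mathcal U_n$ of $X$ which is uniformly bounded (there is $\gamma\in P$ with $U\subseteq B(x,\gamma)$ for all $U\in\mathcal U$,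 $x\in U$) and such that for each $i$ and all distinct $U,V\in\mathcal U_i$ one has $B(U,\alpha)\cap V=\emptyset$. $\operatorname{asdim}$ is the least such $n$, and $\infty$ if there is none. For a group $G$, let $L(G)$ be the set of all subgroups of $G$. The subgroup logarithmic hyperballean $\ell\text{-}\mathcal L(G)$ is the metric ballean on $L(G)$ induced by the extended metric $d(H,K)=\log\max\{|H:H\cap K|,|K:H\cap K|\}$ if both indices are finite, and $d(H,K)=\infty$ otherwise (the base of the logarithm is any fixed real number $>1$). $\mathbb Z_{p^\infty}$ denotes the Prüfer $p$-group. *)

(* Defs.v *)
From HB Require Import structures.
From mathcomp Require Import all_boot all_order all_algebra all_field.
From mathcomp Require Import finmap.
From mathcomp Require Import all_classical all_reals all_analysis.

Set Implicit Arguments.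
Unset Strict Implicit.
Unset Printing Implicit Defensive.

Import Order.TTheory GRing.Theory Num.Theory.

Local Open Scope classical_set_scope.
Local Open Scope ring_scope.

Record ballean := Ballean {
  points :> Type;
  radii : Type;
  bball : points -> radii -> set points;
  radii_inhabited : inhabited radii;
  bball_refl : forall x a, bball x a x;
  bball_sym : forall x y a, bball y a x <-> bball x a y;
  bball_comp : forall a b, exists c, forall x,
    \bigcup_(y in bball x a) bball y b `<=` bball x c
}.

Definition bball_set (X : ballean) (A : set X) (a : radii X) : set X :=
  \bigcup_(y in A) bball y a.

Definition bornologous (X Y : ballean) (f : X -> Y) : Prop :=
  forall a : radii X, exists b : radii Y,
    forall x : X, f @` bball x a `<=` bball (f x) b.

(* A bijection is given together with its inverse [g]. *)
Definition asymorphism (X Y : ballean) (f : X -> Y) : Prop :=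
  exists g : Y -> X,
    [/\ cancel f g, cancel g f, bornologous f & bornologous g].

Definition asymorphic (X Y : ballean) : Prop :=
  exists f : X -> Y, asymorphism f.

Definition uniformly_bounded (X : ballean) (U : set (set X)) : Prop :=
  exists c : radii X, forall A x, U A -> A x -> A `<=` bball x c.

Definition asdim_le (X : ballean) (n : nat) : Prop :=
  forall a : radii X, exists U : 'I_n.+1 -> set (set X),
    [/\ \bigcup_i \bigcup_(A in U i) A = [set: X],
        uniformly_bounded (\bigcup_i U i) &
        forall i A B, U i A -> U i B -> A <> B ->
          bball_set A a `&` B = set0].

(* [None] stands for infinite asymptotic dimension. *)
Definition asdim (X : ballean) : option nat :=
  match pselect (exists n, `[< asdim_le X n >]) with
  | left ex_n => Some (ex_minn ex_n)
  | right _ => None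
  end.

Lemma asdim_SomeP (X : ballean) (n : nat) :
  asdim X = Some n <->
  asdim_le X n /\ (forall m, asdim_le X m -> (n <= m)%N).
Proof.
rewrite /asdim; case: pselect => [ex_n|nex]; last first.
  by split=> // -[Xn _]; case: nex; exists n; apply/asboolP.
case: ex_minnP => k /asboolP Xk kmin; split=> [[<-]|[Xn nmin]].
  by split=> // m Xm; apply: kmin; apply/asboolP.
by congr Some; apply/eqP; rewrite eqn_leq nmin// kmin//; apply/asboolP.
Qed.

Record ext_metric (R : realType) (T : Type) := ExtMetric {
  edist :> T -> T -> \bar R;
  edist_ge0 : forall x y, (0 <= edist x y)%E;
  edist_eq0 : forall x y, edist x y = 0%E <-> x = y;
  edist_sym : forall x y, edist x y = edist y x;
  edist_triangle : forall x y z, (edist x z <= edist x y + edist y z)%E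
}.

Section MetricBallean.
Context (R : realType) (T : Type) (d : ext_metric R T).

Definition closed_eball (x : T) (r : {nonneg R}) : set T :=
  [set y | (d x y <= r%:num%:E)%E].

Lemma closed_eball_refl x r : closed_eball x r x.
Proof.
rewrite /closed_eball/=.
by have /edist_eq0 -> : x = x by []; rewrite lee_fin.
Qed.

Lemma closed_eball_sym x y r : closed_eball y r x <-> closed_eball x r y.
Proof. by rewrite /closed_eball/= edist_sym. Qed.

Lemma closed_eball_comp r s : exists t, forall x,
  \bigcup_(y in closed_eball x r) closed_eball y s `<=` closed_eball x t.
Proof.
exists (r%:num + s%:num)%:nng => x z [y /= xy yz].
rewrite /closed_eball/= (le_trans (edist_triangle d x y z))//.
by rewrite EFinD leeD.
Qed.

Definition metric_ballean : ballean :=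
  Ballean (inhabits (0%:nng : {nonneg R}))
    closed_eball_refl closed_eball_sym closed_eball_comp.

End MetricBallean.

Local Open Scope group_scope.

Record subgroup (G : groupType) := Subgroup {
  subgroup_set :> set G;
  subgroup_closed : group_closed [in subgroup_set]
}.

Section Index.
Context (G : groupType).
Implicit Types H K L : subgroup G.

Definition lcosets (A B : set G) : set (set G) :=
  [set [set x * y | y in B] | x in A].

(* Only meaningful when the set of cosets is finite. *)
Definition gindex (A B : set G) : nat := #|` fset_set (lcosets A B)|.

Definition finite_index (A B : set G) : Prop := finite_set (lcosets A B).

Lemma subgroup_inj H K : (H : set G) = K -> H = K.
Proof.
case: H K => [H Hc] [K Kc] /= E; case: _ / E Kc => Kc.
by congr Subgroup; exact: Prop_irrelevance.
Qed.

Lemma subgroup1 H : subgroup_set H 1.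
Proof. by have [+ _] := subgroup_closed H; rewrite inE. Qed.

Lemma subgroupV H x : subgroup_set H x -> subgroup_set H x^-1.
Proof.
move=> Hx; have /group_closedV Hc := subgroup_closed H.
by have := Hc x; rewrite !inE; exact.
Qed.

Lemma subgroupM H x y : subgroup_set H x -> subgroup_set H y -> subgroup_set H (x * y).
Proof.
move=> Hx Hy; have /group_closedM Hc := subgroup_closed H.
by have := Hc x y; rewrite !inE; exact.
Qed.

Lemma subgroupI_closed H K : group_closed [in (H `&` K)].
Proof.
split=> [|x y]; rewrite !inE; first by split; exact: subgroup1.
by move=> [Hx Kx] [Hy Ky]; split; apply: subgroupM => //; exact: subgroupV.
Qed.

Definition subgroupI H K := Subgroup (subgroupI_closed H K).

Lemma lcoset_eqP H x y :
  [set x * z | z in H] = [set y * z | z in H] <-> subgroup_set H (x^-1 * y).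
Proof.
split=> [E|Hxy].
  have : [set y * z | z in H] y by exists 1; [exact: subgroup1|rewrite mulg1].
  by rewrite -E => -[z Hz <-]; rewrite mulKg.
apply/seteqP; split=> _ [z Hz <-].
  exists ((x^-1 * y)^-1 * z); first by apply: subgroupM => //; exact: subgroupV.
  by rewrite invgM invgK !mulgA mulgV mul1g.
by exists ((x^-1 * y) * z); [exact: subgroupM|rewrite !mulgA mulgV mul1g].
Qed.

Lemma gindex_gt0 H (A : set G) : A 1 -> finite_index A H -> (0 < gindex A H)%N.
Proof.
move=> A1 fin; rewrite cardfs_gt0; apply/fset0Pn.
by exists [set 1 * z | z in H]; rewrite in_fset_set// inE; exists 1.
Qed.

Lemma gindexxx H : finite_index H H /\ gindex H H = 1%N.
Proof.
suff E : lcosets H H = [set [set 1 * z | z in H]].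
  by rewrite /finite_index /gindex E fset_set1 cardfs1; split.
apply/seteqP; split=> [_ [x Hx <-]|_ ->]; last by exists 1 => //; exact: subgroup1.
by apply/lcoset_eqP; rewrite mulg1; exact: subgroupV.
Qed.

Lemma gindex1_sub H (A : set G) :
  A 1 -> finite_index A H -> gindex A H = 1%N -> A `<=` H.
Proof.
move=> A1 fin /eqP/cardfs1P[c E] x Ax.
have lc y : A y -> [set y * z | z in H] = c.
  move=> Ay; apply/eqP; have : [set y * z | z in H] \in fset_set (lcosets A H).
    by rewrite in_fset_set// inE; exists y.
  by rewrite E inE.
have /lcoset_eqP : [set 1 * z | z in H] = [set x * z | z in H] by rewrite !lc.
by rewrite invg1 mul1g.
Qed.

Lemma gindex_triangle H K L :
  finite_index H (H `&` K) -> finite_index K (K `&` L) ->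
  finite_index H (H `&` L) /\
  (gindex H (H `&` L) <= gindex H (H `&` K) * gindex K (K `&` L))%N.
Proof.
move=> fHK fKL.
pose co (M : set G) x := [set x * z | z in M].
pose rep (M : set G) (c : set G) : G := xget 1 [set x | subgroup_set H x /\ co M x = c].
have repP (M : set G) c : lcosets H M c -> subgroup_set H (rep M c) /\ co M (rep M c) = c.
  by move=> [x Hx xc]; apply: (@xgetPex _ 1 [set x | subgroup_set H x /\ co M x = c]); exists x.
pose P := lcosets H (H `&` K) `*` lcosets K (K `&` L).
pose f c := let h := rep (H `&` L) c in
  let r := rep (H `&` K) (co (H `&` K) h) in
  (co (H `&` K) h, co (K `&` L) (r^-1 * h)).
have fP c : lcosets H (H `&` L) c -> P (f c).
  move=> /repP[Hh _]; have hc : lcosets H (H `&` K) (co (H `&` K) (rep (H `&` L) c)).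
    by exists (rep (H `&` L) c).
  split=> //=; exists ((rep (H `&` K) (co (H `&` K) (rep (H `&` L) c)))^-1 * rep (H `&` L) c) => //.
  have [_ /(lcoset_eqP (subgroupI H K))[]] := repP _ _ hc; exact.
have finj c c' : lcosets H (H `&` L) c -> lcosets H (H `&` L) c' ->
    f c = f c' -> c = c'.
  move=> /repP[Hh hc] /repP[Hh' hc'] [E]; rewrite -E.
  move=> /(lcoset_eqP (subgroupI K L))[_].
  rewrite invgM invgK -mulgA (mulgA _ _ (rep _ c')) mulgV mul1g => Lhh.
  rewrite -hc -hc'; apply/(lcoset_eqP (subgroupI H L)); split=> //.
  by apply: subgroupM => //; exact: subgroupV.
have finP : finite_set P by exact: finite_setX.
have inj : {in lcosets H (H `&` L) &, injective f}.
  by move=> c c'; rewrite !inE; exact: finj.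
have sub : f @` lcosets H (H `&` L) `<=` P by move=> _ [c /fP + <-].
have finI : finite_set (f @` lcosets H (H `&` L)) by exact: sub_finite_set finP.
have finL : finite_set (lcosets H (H `&` L)).
  by apply: card_le_finite finI; have := inj_card_eq inj; rewrite card_eq_le => /andP[].
split=> //.
have -> : gindex H (H `&` L) = #|` fset_set (f @` lcosets H (H `&` L))|.
  rewrite fset_set_image// card_in_imfset//= => c c'.
  by rewrite !in_fset_set//; exact: inj.
have -> : (gindex H (H `&` K) * gindex K (K `&` L) = #|` fset_set P|)%N.
  rewrite /gindex fset_setX//; symmetry.
  rewrite (perm_size (enum_imfset2 _ _))/=; first exact: size_allpairs.
  by move=> [? ?] [? ?] _ _ /= [-> ->].
by apply: fsubset_leq_card; rewrite -fset_set_sub.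
Qed.

End Index.

Local Open Scope ring_scope.

Section LogHyperballean.
Context (R : realType) (b : R) (b_gt1 : 1 < b) (G : groupType).
Implicit Types H K L : subgroup G.

Definition commensurable H K : Prop :=
  finite_index H (H `&` K) /\ finite_index K (H `&` K).

Definition log_dist H K : \bar R :=
  if `[< commensurable H K >] then
    (ln (maxn (gindex H (H `&` K)) (gindex K (H `&` K)))%:R / ln b)%:E
  else +oo%E.

Let lnb_gt0 : 0 < ln b. Proof. exact: ln_gt0. Qed.

Let indexI_gt0 H K : commensurable H K ->
  (0 < gindex H (H `&` K))%N /\ (0 < gindex K (H `&` K))%N.
Proof.
by move=> [fH fK]; split; apply: (@gindex_gt0 _ (subgroupI H K)) => //;
  exact: subgroup1.
Qed.

Lemma log_dist_ge0 H K : (0 <= log_dist H K)%E.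
Proof.
rewrite /log_dist; case: asboolP => // /indexI_gt0[H0 K0].
rewrite lee_fin divr_ge0 ?(ltW lnb_gt0)// ln_ge0// ler1n leq_max.
by rewrite H0.
Qed.

Lemma log_dist_eq0 H K : log_dist H K = 0%E <-> H = K.
Proof.
split=> [|<-]; last first.
  have [fin one] := gindexxx H.
  rewrite /log_dist /commensurable !setIid; case: asboolP => [_|[]//].
  by rewrite one maxnn ln1 mul0r.
rewrite /log_dist; case: asboolP => // c [] /eqP.
have [H0 K0] := indexI_gt0 c; case: c => fH fK.
rewrite mulf_eq0 invr_eq0 (gt_eqF lnb_gt0) orbF ln_eq0; last first.
  by rewrite ltr0n leq_max H0.
rewrite pnatr_eq1 => /eqP E.
have H1 : gindex H (H `&` K) = 1%N.
  by apply/eqP; rewrite eqn_leq H0 -E leq_maxl.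
have K1 : gindex K (H `&` K) = 1%N.
  by apply/eqP; rewrite eqn_leq K0 -E leq_maxr.
apply: subgroup_inj; apply/seteqP; split=> x.
  by move=> /(@gindex1_sub _ (subgroupI H K) H (subgroup1 H) fH H1)[].
by move=> /(@gindex1_sub _ (subgroupI H K) K (subgroup1 K) fK K1)[].
Qed.

Lemma log_dist_sym H K : log_dist H K = log_dist K H.
Proof.
rewrite /log_dist /commensurable (setIC H K) maxnC.
by congr (if _ then _ else _); apply/asbool_equiv_eq; rewrite and_comm.
Qed.

Lemma log_dist_triangle H K L :
  (log_dist H L <= log_dist H K + log_dist K L)%E.
Proof.
rewrite {2}/log_dist; case: asboolP => [cHK|_]; last first.
  by rewrite addye ?leey// gt_eqF// (lt_le_trans _ (log_dist_ge0 _ _))// ltNyr.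
rewrite {2}/log_dist; case: asboolP => [cKL|_]; last by rewrite addey ?leey.
have [a0 a0'] := indexI_gt0 cHK; have [b0 b0'] := indexI_gt0 cKL.
case: cHK cKL => fH fK [gK gL].
have [hHL iHL] := gindex_triangle fH gK.
have fK' := fK; have gL' := gL.
rewrite setIC in fK'; rewrite setIC in gL'.
have [hLH iLH] := gindex_triangle gL' fK'.
rewrite (setIC L H) in hLH iLH; rewrite (setIC L K) (setIC K H) in iLH.
have cHL : commensurable H L by split.
rewrite /log_dist; case: asboolP => // _.
rewrite -EFinD lee_fin -mulrDl ler_pM2r ?invr_gt0//.
have [c0 c0'] := indexI_gt0 cHL.
rewrite -lnM ?posrE ?ltr0n ?leq_max ?a0 ?b0//.
rewrite ler_ln ?posrE ?mulr_gt0 ?ltr0n ?leq_max ?a0 ?b0 ?c0//.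
rewrite -natrM ler_nat geq_max (leq_trans iHL) ?leq_mul ?leq_maxl//=.
by rewrite (leq_trans iLH)// mulnC leq_mul ?leq_maxr.
Qed.

Definition log_metric : ext_metric R (subgroup G) :=
  ExtMetric log_dist_ge0 log_dist_eq0 log_dist_sym log_dist_triangle.

Definition log_hyperballean : ballean := metric_ballean log_metric.

End LogHyperballean.

(* The Pruefer p-group, realized as the multiplicative group of the complex
   roots of unity whose order is a power of p. The condition [z != 0] is
   automatic for p > 0; it only keeps [prufer 0] a group. *)
Definition prufer_pred (p : nat) : pred algC :=
  fun z => (z != 0) && `[< exists n : nat, z ^+ (p ^ n)%N = 1 >].

Definition prufer (p : nat) : Type := {z : algC | prufer_pred p z}.

Section Prufer.
Context (p : nat).

HB.instance Definition _ := [isSub of prufer p for sval].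
HB.instance Definition _ := [Choice of prufer p by <:].

Lemma prufer_pred1 : prufer_pred p 1.
Proof. by rewrite /prufer_pred oner_neq0; apply/asboolP; exists 0%N; rewrite expr1n. Qed.

Lemma prufer_predM x y :
  prufer_pred p x -> prufer_pred p y -> prufer_pred p (x * y).
Proof.
move=> /andP[x0 /asboolP[m xm]] /andP[y0 /asboolP[n yn]].
rewrite /prufer_pred mulf_neq0//; apply/asboolP; exists (m + n)%N.
by rewrite exprMn {1}expnD exprM xm expr1n mul1r addnC expnD exprM yn expr1n.
Qed.

Lemma prufer_predV x : prufer_pred p x -> prufer_pred p x^-1.
Proof.
move=> /andP[x0 /asboolP[n xn]]; rewrite /prufer_pred invr_neq0//.
by apply/asboolP; exists n; rewrite exprVn xn invr1.
Qed.

Definition prufer_one : prufer p := exist _ 1 prufer_pred1.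
Definition prufer_mul (x y : prufer p) : prufer p :=
  exist _ (sval x * sval y) (prufer_predM (svalP x) (svalP y)).
Definition prufer_inv (x : prufer p) : prufer p :=
  exist _ (sval x)^-1 (prufer_predV (svalP x)).

Lemma prufer_mulA : associative prufer_mul.
Proof. by move=> x y z; apply: val_inj; rewrite /= mulrA. Qed.

Lemma prufer_mul1 : left_id prufer_one prufer_mul.
Proof. by move=> x; apply: val_inj; rewrite /= mul1r. Qed.

Lemma prufer_mulr1 : right_id prufer_one prufer_mul.
Proof. by move=> x; apply: val_inj; rewrite /= mulr1. Qed.

Lemma prufer_mulV : left_inverse prufer_one prufer_inv prufer_mul.
Proof.
by move=> x; apply: val_inj => /=; rewrite mulVf//; have /andP[] := svalP x.
Qed.

Lemma prufer_mulrV : right_inverse prufer_one prufer_inv prufer_mul.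
Proof.
by move=> x; apply: val_inj => /=; rewrite mulfV//; have /andP[] := svalP x.
Qed.

HB.instance Definition _ := isGroup.Build (prufer p)
  prufer_mulA prufer_mul1 prufer_mulr1 prufer_mulV prufer_mulrV.

End Prufer.

(* Main.v *)
Require Import Defs.
From mathcomp Require Import all_boot all_order all_algebra all_reals.
From mathcomp Require Import all_field all_classical all_analysis zify.
Import Order.TTheory GRing.Theory Num.Theory.
Set Implicit Arguments.
Unset Strict Implicit.
Unset Printing Implicit Defensive.
Local Open Scope classical_set_scope.
Local Open Scope ring_scope.

(** The subgroups of the Pruefer p-group form a chain: the finite subgroups
    G_0 < G_1 < ..., where G_n consists of the solutions of z^(p^n) = 1, and
    the whole group (lemma [level_surj]).  Indeed, the group of all solutions
    of z^(p^n) = 1 is generated by any element of exact order p^n, so a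
    subgroup is determined by the orders of its elements.

    For m <= n the index of G_m in G_n is p^(n-m), so the logarithmic distance
    between G_m and G_n is |m - n| times the constant log_b p; the index of
    G_m in the whole group is infinite.  Hence the hyperballean is, up to the
    scaling factor log_b p, the ray of natural numbers together with one point
    at infinite distance from it (lemma [level_pointed_ray]).

    The scaling factor is invisible to bornologous maps, so the hyperballeans
    for two primes are asymorphic (lemma [pointed_ray_asymorphic]).  Their
    asymptotic dimension is that of the ray (lemma [pointed_ray_asdim]).  It is
    at most 1, because the ray is cut into intervals of equal length, put
    alternately into two families.  It is not 0, because a single family that
    is separated at the scale of one step has a member containing all natural
    numbers, and that member is unbounded. *)

(** * The natural numbers with an extra point at infinity *)

(** The disjoint union of the ray of natural numbers and one point [None] at
    infinite distance from it, given through a parametrization [phi]; the step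
    [c] is a parameter because it alone depends on the prime. *)
Definition pointed_ray (R : realType) (T : Type) (d : ext_metric R T) (c : R)
    (phi : option nat -> T) : Prop :=
  [/\ 0 < c, bijective phi,
      forall m n, d (phi (Some m)) (phi (Some n)) =
        (c * (maxn m n - minn m n)%:R)%:E &
      forall n, d (phi (Some n)) (phi None) = +oo%E].

Section PointedRay.
Context {R : realType}.

(** Both distances are fixed multiples of one and the same distance between the
    indices, so a closed ball for [d] is carried into a closed ball for [e]
    whose radius is multiplied by the quotient of the two steps. *)
Lemma pointed_ray_le (S T : Type) (d : ext_metric R S) (e : ext_metric R T)
    (a b r : R) (phi : option nat -> S) (psi : option nat -> T) u v :
  pointed_ray d a phi -> pointed_ray e b psi -> 0 <= r ->
  (d (phi u) (phi v) <= r%:E)%E -> (e (psi u) (psi v) <= (b / a * r)%:E)%E.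
Proof.
move=> [a0 _ dS dN] [b0 _ eS eN] r0.
case: u v => [m|] [n|].
- rewrite dS eS !lee_fin => mn.
  by rewrite -mulrA ler_pM2l// mulrC ler_pdivlMr// mulrC.
- by rewrite dN.
- by rewrite Defs.edist_sym dN.
- have /Defs.edist_eq0 -> : psi None = psi None by [].
  by rewrite lee_fin mulr_ge0// divr_ge0// ltW.
Qed.

Lemma pointed_ray_asymorphic (S T : Type) (d : ext_metric R S)
    (e : ext_metric R T) (a b : R) (phi : option nat -> S)
    (psi : option nat -> T) :
  pointed_ray d a phi -> pointed_ray e b psi ->
  asymorphic (metric_ballean d) (metric_ballean e).
Proof.
move=> dphi epsi.
have [a0 [phi' phiK phi'K] _ _] := dphi.
have [b0 [psi' psiK psi'K] _ _] := epsi.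
exists (psi \o phi'), (phi \o psi'); split.
- by move=> x /=; rewrite psiK phi'K.
- by move=> y /=; rewrite phiK psi'K.
- move=> r; have k0 : 0 <= b / a * r%:num by rewrite mulr_ge0// divr_ge0// ltW.
  exists (NngNum k0) => x _ [y /= xy <-]; rewrite /closed_eball/=.
  by apply: (pointed_ray_le dphi epsi) => //; rewrite !phi'K.
- move=> r; have k0 : 0 <= a / b * r%:num by rewrite mulr_ge0// divr_ge0// ltW.
  exists (NngNum k0) => x _ [y /= xy <-]; rewrite /closed_eball/=.
  by apply: (pointed_ray_le epsi dphi) => //; rewrite !psi'K.
Qed.

(** Two blocks of length [w] with the same parity are equal or have a whole
    block between them, which is what separates each of the two families in
    the cover of the ray. *)
Lemma same_parity_divn (w m n : nat) : (0 < w)%N ->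
  odd (m %/ w) = odd (n %/ w) -> (maxn m n - minn m n < w)%N ->
  (m %/ w = n %/ w)%N.
Proof.
move=> w0; wlog mn : m n / (m <= n)%N => [th|].
  by case/orP: (leq_total m n) => [/th//|/th h o]; rewrite maxnC minnC => /h ->.
rewrite (maxn_idPr mn) (minn_idPl mn) => o lt_w.
have le1 : (n %/ w <= (m %/ w).+1)%N.
  have : (n <= m + w)%N by lia.
  by move=> /(leq_div2r w); rewrite divnDr// divnn w0 addn1.
have := leq_div2r w mn.
by move: o le1; set i := (m %/ w)%N; set j := (n %/ w)%N; lia.
Qed.

(** Cut the ray into blocks of [w] consecutive points, where [w] steps exceed
    the given radius, and sort the blocks by parity.  The point at infinity is
    a member by itself; being infinitely far from everything, it may join
    either family and is put with the even blocks. *)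
Lemma pointed_ray_asdim_le1 (T : Type) (d : ext_metric R T) (c : R)
    (phi : option nat -> T) :
  pointed_ray d c phi -> asdim_le (metric_ballean d) 1.
Proof.
move=> [c0 [phi' phiK phi'K] dS dN] r.
pose w := (Num.truncn (r%:num / c)).+1.
have w0 : (0 < w)%N by [].
have lt_w m n : (d (phi (Some m)) (phi (Some n)) <= r%:num%:E)%E ->
    (maxn m n - minn m n < w)%N.
  rewrite dS lee_fin -ler_pdivlMl// mulrC => h.
  by rewrite -(ltr_nat R) (le_lt_trans h)// truncnS_gt.
pose blk := omap (divn^~ w).
exists (fun i => [set A : set T | exists v,
  oapp odd false v = odd i /\ A = [set phi u | u in [set u | blk u = v]]]%classic).
split.
- apply/seteqP; split=> // x _.
  exists (inord (oapp odd false (blk (phi' x)))) => //.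
  exists [set phi u | u in [set u | blk u = blk (phi' x)]]%classic.
    exists (blk (phi' x)); split=> //.
    by rewrite inordK//; case: (oapp _ _ _).
  by exists (phi' x).
- have cw : 0 <= c * w%:R by rewrite mulr_ge0// ltW.
  exists (NngNum cw) => A x [i _ [v [_ ->]]] [u /= uv <-] _ [u' /= uv' <-].
  rewrite /closed_eball/=; case: u u' uv uv' => [m|] [n|] <-//.
    move=> [E]; rewrite dS lee_fin ler_pM2l// ler_nat.
    have := divn_eq m w; have := divn_eq n w; rewrite E.
    by have := ltn_pmod m w0; have := ltn_pmod n w0; lia.
  by move=> _; have /Defs.edist_eq0 -> : phi None = phi None by []; rewrite lee_fin.
- move=> i A B [v [vi ->]] [v' [vi' ->]] AB.
  apply/seteqP; split=> // x [[_ [u /= uv <-] /=]].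
  rewrite /closed_eball/= => + [u' /= uv' ux]; rewrite -{}ux => uu'.
  apply: AB; congr [set phi u | u in [set u | blk u = _]]%classic.
  case: u u' uv uv' uu' => [m|] [n|] /= uv uv'.
  + move=> /lt_w mn; move: vi vi'; rewrite -uv -uv' /= => <- o.
    by rewrite (@same_parity_divn w m n).
  + by rewrite dN.
  + by rewrite Defs.edist_sym dN.
  + by rewrite -uv -uv'.
Qed.

(** At the scale of a single step, consecutive points of the ray lie in the same
    member of a one-family cover, so by induction one member contains the whole
    ray; no ball around its origin does. *)
Lemma pointed_ray_asdim_gt0 (T : Type) (d : ext_metric R T) (c : R)
    (phi : option nat -> T) :
  pointed_ray d c phi -> ~ asdim_le (metric_ballean d) 0.
Proof.
move=> [c0 _ dS _] /(_ (NngNum (ltW c0))) [U [cov [r bnd] sep]].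
have inU x : exists2 A, U ord0 A & A x.
  have : [set: T]%classic x by [].
  by rewrite -cov => -[i _ [A]]; rewrite ord1; exists A.
have [A UA A0] := inU (phi (Some 0%N)).
have An n : A (phi (Some n)).
  elim: n => // n An; have [B UB Bn] := inU (phi (Some n.+1)).
  have [->//|/eqP AB] := eqVneq A B.
  have : set0 (phi (Some n.+1)) by rewrite -(sep ord0 A B)//; split=> //;
    exists (phi (Some n)) => //; rewrite /= /closed_eball /= dS lee_fin;
    rewrite (_ : (_ - _)%N = 1%N) ?mulr1//; lia.
  by [].
pose n := (Num.truncn (r%:num / c)).+1.
have UA' : (\bigcup_i U i)%classic A by exists ord0.
have := bnd _ _ UA' (An 0%N) _ (An n).
rewrite /= /closed_eball/= dS max0n min0n subn0 lee_fin -ler_pdivlMl// mulrC.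
by rewrite leNgt truncnS_gt.
Qed.

Lemma pointed_ray_asdim (T : Type) (d : ext_metric R T) (c : R)
    (phi : option nat -> T) :
  pointed_ray d c phi -> asdim (metric_ballean d) = Some 1%N.
Proof.
move=> dphi; apply/asdim_SomeP; split; first exact: pointed_ray_asdim_le1 dphi.
by case=> // /(pointed_ray_asdim_gt0 dphi).
Qed.

End PointedRay.

(** * Subgroups of the Pruefer group *)

Lemma subgroupX (G : groupType) (H : subgroup G) x k :
  subgroup_set H x -> subgroup_set H (x ^+ k)%g.
Proof.
move=> Hx; elim: k => [|k IHk]; first exact: subgroup1.
by rewrite expgS; exact: subgroupM.
Qed.

Section PruferSubgroups.
Context (p : nat) (p_pr : prime p).

Definition level_set (o : option nat) : set (prufer p) :=
  if o is Some n then [set z | val z ^+ (p ^ n) = 1]%classic else setT.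

Lemma level_closed o : group_closed [in level_set o].
Proof.
split=> [|x y]; case: o => [n|]; rewrite !inE //=.
- by rewrite expr1n.
- by move=> xn yn; rewrite exprMn exprVn xn yn invr1 mulr1.
Qed.

Definition level o : subgroup (prufer p) := Subgroup (level_closed o).

Lemma val_expg (z : prufer p) k : val (z ^+ k)%g = val z ^+ k.
Proof. by elim: k => // k IHk; rewrite expgS exprS -IHk. Qed.

Lemma level_mono m n : (m <= n)%N -> level_set (Some m) `<=` level_set (Some n).
Proof.
move=> mn z /= zm; rewrite -(subnKC mn) expnD exprM.
by rewrite zm expr1n.
Qed.

Lemma prufer_order (z : prufer p) : exists n, (p ^ n)%N.-primitive_root (val z).
Proof.
have /andP[_ /asboolP[n zn]] := svalP z.
have pn_gt0 : (0 < p ^ n)%N by rewrite expn_gt0 prime_gt0.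
have [m zm /(dvdn_pfactor _ _ p_pr)[k _ mk]] := prim_order_exists pn_gt0 zn.
by exists k; rewrite -mk.
Qed.

Lemma prufer_gen n : exists w : prufer p, (p ^ n)%N.-primitive_root (val w).
Proof.
have pn_gt0 : (0 < p ^ n)%N by rewrite expn_gt0 prime_gt0.
have [w wn] := C_prim_root_exists pn_gt0.
have w1 : w ^+ (p ^ n) = 1 by exact: prim_expr_order.
suff wp : prufer_pred p w by exists (exist _ w wp).
rewrite /prufer_pred -unitfE -(unitrX_pos _ pn_gt0) w1 unitr1.
by apply/asboolP; exists n.
Qed.

Lemma level_powers n (w z : prufer p) :
  (p ^ n)%N.-primitive_root (val w) -> level_set (Some n) z ->
  exists i, z = (w ^+ i)%g.
Proof.
move=> wn /(prim_rootP wn)[i zi]; exists i.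
by apply: val_inj; rewrite val_expg.
Qed.

(** The solutions of z^(p^n) = 1 are the powers of any one primitive root, so a
    single element of exact order p^n brings its whole level into [H]. *)
Lemma level_sub (H : subgroup (prufer p)) n z :
  subgroup_set H z -> (p ^ n)%N.-primitive_root (val z) ->
  level_set (Some n) `<=` subgroup_set H.
Proof. by move=> Hz zn y /(level_powers zn)[i ->]; exact: subgroupX. Qed.

Lemma notin_level n k (z : prufer p) :
  (p ^ k)%N.-primitive_root (val z) -> ~ level_set (Some n) z -> (n < k)%N.
Proof.
move=> zk nz; rewrite ltnNge; apply/negP => kn; apply: nz.
by apply: (level_mono kn); exact: prim_expr_order.
Qed.

(** If the orders of the elements of [H] are bounded, let [n] be least with [H]
    inside level [n]; by minimality some element of [H] has exact order p^n, and
    it generates that level.  If they are unbounded, then [H] contains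
    generators of arbitrarily high levels, and so every element. *)
Lemma level_surj (H : subgroup (prufer p)) : exists o, level o = H.
Proof.
pose bounded n := `[< subgroup_set H `<=` level_set (Some n) >].
have [bnd|unb] := pselect (exists n, bounded n).
  have [n /asboolP Hn nmin] := ex_minnP bnd.
  exists (Some n); apply: subgroup_inj; apply/seteqP; split=> //.
  case: n Hn nmin => [|n] Hn nmin.
    move=> z /= z1; rewrite (_ : z = 1%g); first exact: subgroup1.
    exact: val_inj.
  have [z Hz nz] : exists2 z, subgroup_set H z & ~ level_set (Some n) z.
    apply: contrapT => h; suff /asboolP/nmin : subgroup_set H `<=` level_set (Some n).
      by rewrite ltnn.
    by move=> z Hz; apply: contrapT => nz; apply: h; exists z.
  have [k zk] := prufer_order z.
  have nk := notin_level zk nz.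
  by move=> y /(level_mono nk); exact: level_sub Hz zk _.
exists None; apply: subgroup_inj; apply/seteqP; split=> // y _.
have [n yn] := prufer_order y.
have [z Hz nz] : exists2 z, subgroup_set H z & ~ level_set (Some n) z.
  apply: contrapT => h; apply: unb; exists n; apply/asboolP => z Hz.
  by apply: contrapT => nz; apply: h; exists z.
have [k zk] := prufer_order z.
apply: (level_sub Hz zk); apply: (level_mono (ltnW (notin_level zk nz))).
exact: prim_expr_order.
Qed.

(** Let [w] generate level [n].  The powers of [w] with exponents i and j lie in
    the same coset of level [m] exactly when p^n divides (j - i) p^m, that is
    when i = j modulo p^(n-m); so the exponents below p^(n-m) represent every
    coset once. *)
Lemma card_lcosets_level m n : (m <= n)%N ->
  (lcosets (level_set (Some n)) (level_set (Some m)) #= `I_(p ^ (n - m)))%card.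
Proof.
move=> mn; have [w wn] := prufer_gen n.
pose co i := [set ((w ^+ i)%g * z)%g | z in level_set (Some m)]%classic.
have coE i j : co i = co j <-> (i = j %[mod p ^ (n - m)])%N.
  rewrite /co (lcoset_eqP (level (Some m))) /= val_expg val_expg.
  rewrite exprMn exprVn -!exprM.
  have u0 : val w ^+ (i * p ^ m) \is a GRing.unit.
    by rewrite unitfE expf_neq0//; have /andP[] := svalP w.
  have -> : (val w ^+ (i * p ^ m))^-1 * val w ^+ (j * p ^ m) = 1 <->
      val w ^+ (i * p ^ m) == val w ^+ (j * p ^ m).
    split=> [h|/eqP <-]; last by rewrite mulVr.
    by apply/eqP; rewrite -[RHS](mulVKr u0) h mulr1.
  rewrite (eq_prim_root_expr wn) -{1 2}(subnK mn) expnD.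
  rewrite -!muln_modl eqn_pmul2r ?expn_gt0 ?prime_gt0//.
  by split=> /eqP.
have -> : lcosets (level_set (Some n)) (level_set (Some m)) =
    (co @` `I_(p ^ (n - m)))%classic.
  apply/seteqP; split=> [_ [x /(level_powers wn)[i ->] <-]|_ [i _ <-]].
    exists (i %% p ^ (n - m))%N; first by rewrite /= ltn_pmod// expn_gt0 prime_gt0.
    by apply/coE; rewrite modn_mod.
  exists (w ^+ i)%g => //; apply: (subgroupX (H := level (Some n))).
  exact: prim_expr_order.
apply: inj_card_eq => i j; rewrite !inE /= => ilt jlt /coE.
by rewrite !modn_small.
Qed.

Lemma finite_index_level m n : (m <= n)%N ->
  finite_index (level_set (Some n)) (level_set (Some m)) /\
  gindex (level_set (Some n)) (level_set (Some m)) = (p ^ (n - m))%N.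
Proof.
move=> /card_lcosets_level mn; split; first by exists (p ^ (n - m))%N.
exact: card_fset_set.
Qed.

(** Level [n + N] alone already meets p^N > N cosets of level [n]. *)
Lemma infinite_index_level n :
  ~ finite_index (level_set None) (level_set (Some n)).
Proof.
move=> [N /card_eqPle[TN _]].
have sub : (lcosets (level_set (Some (n + N))) (level_set (Some n)) #<=
    lcosets (level_set None) (level_set (Some n)))%card.
  by apply: subset_card_le => _ [x _ <-]; exists x.
have /card_eqPle[_ le] := card_lcosets_level (leq_addr N n).
have := card_le_trans (card_le_trans le sub) TN.
by rewrite card_le_II addKn leqNgt ltn_expl// prime_gt1.
Qed.

Lemma level_setI m n : (m <= n)%N ->
  level_set (Some n) `&` level_set (Some m) = level_set (Some m).
Proof. by move=> /level_mono mn; apply: setIidr. Qed.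

(** * Logarithmic distances between the subgroups *)

Context (R : realType) (b : R) (b_gt1 : 1 < b).

Lemma log_dist_level m n :
  log_metric b_gt1 (prufer p) (level (Some m)) (level (Some n)) =
  (ln p%:R / ln b * (maxn m n - minn m n)%:R)%:E.
Proof.
wlog mn : m n / (m <= n)%N => [th|].
  case/orP: (leq_total m n) => [/th//|/th h].
  by rewrite Defs.edist_sym maxnC minnC.
rewrite (maxn_idPr mn) (minn_idPl mn) /= /log_dist /commensurable /= setIC.
rewrite (level_setI mn).
have [f1 i1] := finite_index_level (leqnn m).
have [f2 i2] := finite_index_level mn.
case: asboolP => [_|[]//].
rewrite i1 i2 subnn (maxn_idPr _) ?expn_gt0 ?prime_gt0//.
by rewrite natrX lnXn ?ltr0n ?prime_gt0// mulr_natr mulrnAl.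
Qed.

Lemma log_dist_levelT n :
  log_metric b_gt1 (prufer p) (level (Some n)) (level None) = +oo%E.
Proof.
rewrite /= /log_dist; case: asboolP => // -[_ /=].
by rewrite setIT => /infinite_index_level.
Qed.

(** Distinct indices are at nonzero distance, so injectivity of [level] is read
    off from the distances. *)
Lemma level_pointed_ray :
  pointed_ray (log_metric b_gt1 (prufer p)) (ln p%:R / ln b) level.
Proof.
have c0 : 0 < ln p%:R / ln b by rewrite divr_gt0 ?ln_gt0// ltr1n prime_gt1.
have level_inj : injective level.
  have inf n : level (Some n) <> level None.
    move=> E; have := log_dist_levelT n; rewrite E.
    by have /Defs.edist_eq0 -> : level None = level None by [].
  move=> [m|] [n|] // E; [|by case: (inf m)|by case: (inf n)].
  have := log_dist_level m n; rewrite E.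
  have /Defs.edist_eq0 -> : level (Some n) = level (Some n) by [].
  move=> [] /esym/eqP; rewrite mulf_eq0 (gt_eqF c0)/= pnatr_eq0 => /eqP mn.
  by congr Some; lia.
split=> //; [|exact: log_dist_level|exact: log_dist_levelT].
have [g gK] := choice level_surj.
by exists g => // o; apply: level_inj; rewrite gK.
Qed.

End PruferSubgroups.

Theorem corollary3p19 (R : realType) (b : R) (b_gt1 : 1 < b) :
  (forall p q : nat, prime p -> prime q ->
     asymorphic (log_hyperballean b_gt1 (prufer p))
                (log_hyperballean b_gt1 (prufer q))) /\
  (forall p : nat, prime p ->
     asdim (log_hyperballean b_gt1 (prufer p)) = Some 1%N).
Proof.
split=> [p q p_pr q_pr|p p_pr].
  exact: pointed_ray_asymorphic (level_pointed_ray p_pr b_gt1)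
    (level_pointed_ray q_pr b_gt1).
exact: pointed_ray_asdim (level_pointed_ray p_pr b_gt1).
Qed.
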